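(* The minimal-solution algorithm described in the context, run on an $m\times n$ matrix $A$, a vector $b$ and a solution $x\in S(A,b)$, terminates after $O(m^3)$ or $O(n^3)$ operations, i.e. after $O(\max\{m,n\}^3)$ operations.
   Context: Let $I=\{1,\dots,m\}$, $J=\{1,\dots,n\}$, $A=(a_{ij})_{m\times n}$ with $a_{ij}\in[0,1]$, and $b=(b_1,\dots,b_m)$ with $b_i>0$ real. The Łukasiewicz t-norm is $T_L(a,x)=\max\{a+x-1,0\}$ on $[0,1]^2$, and $S(A,b)=\{x\in[0,1]^n : \sum_{j\in J}T_L(a_{ij},x_j)\ge b_i \text{ for all } i\in I\}$. For $x\in S(A,b)$ and $j\in J$, define $F_j(x)=\{t\in[0,1] : T_L(a_{ij},t)+\sum_{k\in J\setminus\{j\}}T_L(a_{ik},x_k)\ge b_i \text{ for all } i\in I\}$ and $\delta_j(x)=\min F_j(x)$. Let $\hat x=(1,\dots,1)$. Algorithm (input $x\in S(A,b)$, output $\check x$): (1) Compute $\tilde x=(\delta_1(\hat x),\dots,\delta_n(\hat x))$; if $\tilde x\in S(A,b)$, output $\check x:=\tilde x$ and stop. (2) Otherwise set $x^{(0)}:=x$ and for $j=1,2,\dots,n$ in turn compute $F_j(x^{(j-1)})$ and $\delta_j(x^{(j-1)})$, and let $x^{(j)}$ be the vector obtained from $x^{(j-1)}$ by replacing its $j$-th coordinate by $\delta_j(x^{(j-1)})$. (3) Output $\check x:=x^{(n)}$. Operations are elementary operations on real numbers (arithmetic operations and comparisons, including taking the maximum or minimum of two numbers). *)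

(* Defs.v *)
From HB Require Import structures.
From mathcomp Require Import all_boot all_order all_algebra.
From mathcomp Require Import boolp classical_sets reals.

Set Implicit Arguments.
Unset Strict Implicit.
Unset Printing Implicit Defensive.

Import Order.TTheory GRing.Theory Num.Theory.

Local Open Scope classical_set_scope.
Local Open Scope ring_scope.

Definition TL (R : realType) (a x : R) : R := Num.max (a + x - 1) 0.

Definition sol (R : realType) (m n : nat) (A : 'M[R]_(m, n)) (b : 'rV[R]_m) :
    set 'rV[R]_n :=
  [set x | (forall j, 0 <= x ord0 j <= 1) /\
           (forall i, b ord0 i <= \sum_j TL (A i j) (x ord0 j))].

Definition Fset (R : realType) (m n : nat) (A : 'M[R]_(m, n)) (b : 'rV[R]_m)
    (j : 'I_n) (x : 'rV[R]_n) : set R :=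
  [set t | 0 <= t <= 1 /\
           (forall i, b ord0 i <=
              TL (A i j) t + \sum_(k | k != j) TL (A i k) (x ord0 k))].

Definition is_min (R : realType) (E : set R) (t : R) : Prop :=
  E t /\ (forall s, E s -> t <= s).

(* The type of entries is arbitrary so that programs can use it too. *)
Definition set_coord (V : Type) (n : nat) (x : 'rV[V]_n) (j : 'I_n) (t : V) :
    'rV[V]_n :=
  \row_k (if k == j then t else x ord0 k).

(* [is_output A b x y]: y is the vector that the algorithm returns on input x.
   It is a relation, so it asserts in particular that all the minima
   delta_j used along the way exist. [X j] is the vector x^(j); as 'I_n is
   0-based, step j : 'I_n leads from [X j] to [X j.+1]. *)
Definition is_output (R : realType) (m n : nat) (A : 'M[R]_(m, n))
    (b : 'rV[R]_m) (x y : 'rV[R]_n) : Prop :=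
  exists xt : 'rV[R]_n,
    (forall j, is_min (Fset A b j (const_mx 1)) (xt ord0 j)) /\
    ((sol A b xt /\ y = xt) \/
     (~ sol A b xt /\
      exists X : nat -> 'rV[R]_n,
        [/\ X 0%N = x,
            forall j : 'I_n, exists t,
              is_min (Fset A b j (X j)) t /\ X j.+1 = set_coord (X j) j t
          & y = X n])).

(* Programs over an abstract type V of numbers. Those below are polymorphic
   in V, hence can act on numbers only through the counted instructions
   [Arith] and [Test]. *)
Inductive op := Add | Sub | Mul | Div | Max | Min.

Inductive prog (V X : Type) : Type :=
| Ret of X
| Arith of op & V & V & (V -> prog V X)
| Test of V & V & (bool -> prog V X).

Arguments Ret {V X}.
Arguments Arith {V X}.
Arguments Test {V X}.

Definition arith (V : Type) (o : op) (u v : V) : prog V V := Arith o u v Ret.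
(* [test u v] decides u <= v. *)
Definition test (V : Type) (u v : V) : prog V bool := Test u v Ret.

Fixpoint bind (V X Y : Type) (p : prog V X) (f : X -> prog V Y) : prog V Y :=
  match p with
  | Ret x => f x
  | Arith o u v k => Arith o u v (fun w => bind (k w) f)
  | Test u v k => Test u v (fun c => bind (k c) f)
  end.

Notation "'do' x <- p ; q" := (bind p (fun x => q))
  (at level 200, x name, p at level 100, q at level 200, right associativity).

Fixpoint loop (V X I : Type) (f : X -> I -> prog V X) (x : X) (s : seq I) :
    prog V X :=
  match s with
  | [::] => Ret x
  | i :: s' => do y <- f x i; loop f y s'
  end.

Definition eval_op (R : realType) (o : op) (u v : R) : R :=
  match o with
  | Add => u + v
  | Sub => u - v
  | Mul => u * v
  | Div => u / v
  | Max => Num.max u v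
  | Min => Num.min u v
  end.

(* The result of a program on real numbers, and its number of operations. *)
Fixpoint run (R : realType) (X : Type) (p : prog R X) : X * nat :=
  match p with
  | Ret x => (x, 0%N)
  | Arith o u v k => let: (x, c) := run (k (eval_op o u v)) in (x, c.+1)
  | Test u v k => let: (x, c) := run (k (u <= v)) in (x, c.+1)
  end.

(* In the programs below, zero and one are the literals 0 and 1. *)
Definition prog_TL (V : Type) (zero one a x : V) : prog V V :=
  do s <- arith Add a x;
  do d <- arith Sub s one;
  arith Max d zero.

(* The sum of TL (A i k) (x k) over the indices k in the list s. *)
Definition prog_sum (V : Type) (zero one : V) (m n : nat) (A : 'M[V]_(m, n))
    (x : 'rV[V]_n) (i : 'I_m) (s : seq 'I_n) : prog V V :=
  loop (fun acc k =>
          do t <- prog_TL zero one (A i k) (x ord0 k);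
          arith Add acc t)
       zero s.

(* For x in [0,1]^n, decides whether x belongs to S(A,b). *)
Definition prog_sol (V : Type) (zero one : V) (m n : nat) (A : 'M[V]_(m, n))
    (b : 'rV[V]_m) (x : 'rV[V]_n) : prog V bool :=
  loop (fun ok i =>
          do s <- prog_sum zero one A x i (enum 'I_n);
          do c <- test (b ord0 i) s;
          Ret (ok && c))
       true (enum 'I_m).

(* The two endpoints of the closed interval F_j(x). With s the sum over
   k != j, the i-th constraint TL (A i j) t + s >= b i on t in [0,1] is void
   if b i <= s, and means (1 - A i j) + (b i - s) <= t otherwise. *)
Definition prog_F (V : Type) (zero one : V) (m n : nat) (A : 'M[V]_(m, n))
    (b : 'rV[V]_m) (j : 'I_n) (x : 'rV[V]_n) : prog V (V * V) :=
  do lo <-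
    loop (fun lo i =>
            do s <- prog_sum zero one A x i [seq k <- enum 'I_n | k != j];
            do c <- test (b ord0 i) s;
            if c then Ret lo else
            do r <- arith Sub (b ord0 i) s;
            do d <- arith Sub one (A i j);
            do t <- arith Add d r;
            arith Max lo t)
         zero (enum 'I_m);
  Ret (lo, one).

Definition prog_delta (V : Type) (zero one : V) (m n : nat) (A : 'M[V]_(m, n))
    (b : 'rV[V]_m) (j : 'I_n) (x : 'rV[V]_n) : prog V V :=
  do F <- prog_F zero one A b j x;
  Ret F.1.

Definition algorithm (V : Type) (zero one : V) (m n : nat) (A : 'M[V]_(m, n))
    (b : 'rV[V]_m) (x : 'rV[V]_n) : prog V 'rV[V]_n :=
  let xhat : 'rV[V]_n := const_mx one in
  do xt <-
    loop (fun y j =>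
            do d <- prog_delta zero one A b j xhat;
            Ret (set_coord y j d))
         xhat (enum 'I_n);
  do ok <- prog_sol zero one A b xt;
  if ok then Ret xt else
  loop (fun y j =>
          do d <- prog_delta zero one A b j y;
          Ret (set_coord y j d))
       x (enum 'I_n).

(* Main.v *)
(* For t in [0,1], the constraint b_i <= TL a t + s holds exactly when b_i <= s
   or (1 - a) + (b_i - s) <= t, so F_j(x) is the part of [0,1] above the number
   computed by [prog_delta]; it contains x_j when x is in S(A,b), so this number
   is the minimum.  Replacing x_j by it stays in S(A,b), so all
   the minima used exist.  One delta costs at most m (4n + 5) operations, and at
   most 2n of them are computed, besides one membership test of cost at most
   m (4n + 1). *)
Require Import Defs.
From HB Require Import structures.
From mathcomp Require Import all_boot all_order all_algebra.
From mathcomp Require Import boolp classical_sets reals.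
From mathcomp Require Import zify lra.

Import Order.TTheory GRing.Theory Num.Theory.

Local Open Scope ring_scope.

Definition result {R : realType} {X : Type} (p : prog R X) : X := (run p).1.
Definition cost {R : realType} {X : Type} (p : prog R X) : nat := (run p).2.

Lemma run_bind (R : realType) (X Y : Type) (p : prog R X) (f : X -> prog R Y) :
  run (bind p f) = (result (f (result p)), (cost p + cost (f (result p)))%N).
Proof.
rewrite /result /cost; elim: p => [x|o u v k IH|u v k IH] /=.
- by case: (run _).
- by rewrite IH; case: (run (k _)).
- by rewrite IH; case: (run (k _)).
Qed.

Lemma result_bind (R : realType) (X Y : Type) (p : prog R X)
    (f : X -> prog R Y) :
  result (bind p f) = result (f (result p)).
Proof. by rewrite {1}/result run_bind. Qed.

Lemma cost_bind (R : realType) (X Y : Type) (p : prog R X)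
    (f : X -> prog R Y) :
  cost (bind p f) = (cost p + cost (f (result p)))%N.
Proof. by rewrite {1}/cost run_bind. Qed.

Lemma result_loop (R : realType) (X I : Type) (f : X -> I -> prog R X) (x : X)
    (s : seq I) :
  result (loop f x s) = foldl (fun y i => result (f y i)) x s.
Proof. by elim: s x => //= i s IH x; rewrite result_bind IH. Qed.

(** The bound [c] is uniform in the state [y], so no intermediate value has to be tracked when
    counting. *)
Lemma cost_loop (R : realType) (X I : Type) (f : X -> I -> prog R X) (x : X)
    (s : seq I) (c : nat) :
  (forall y i, (cost (f y i) <= c)%N) -> (cost (loop f x s) <= size s * c)%N.
Proof.
move=> fc; elim: s x => //= i s IH x.
by rewrite cost_bind mulSn leq_add.
Qed.

Lemma foldl_addr (V : nmodType) (I : Type) (F : I -> V) (a : V) (s : seq I) :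
  foldl (fun y i => y + F i) a s = a + \sum_(i <- s) F i.
Proof.
elim: s a => [|i s IH] a /=; first by rewrite big_nil addr0.
by rewrite IH big_cons addrA.
Qed.

(** This describes the first phase: [g] does not depend on the accumulator, so order and repetitions
    in [s] are immaterial. *)
Lemma foldl_set_coord (V : Type) (n : nat) (g : 'I_n -> V) (x : 'rV[V]_n)
    (s : seq 'I_n) (k : 'I_n) :
  foldl (fun y j => set_coord y j (g j)) x s ord0 k =
  if k \in s then g k else x ord0 k.
Proof.
elim: s x => //= j s IH x; rewrite IH in_cons mxE.
by case: (k \in s); rewrite ?orbT ?orbF //; case: eqP => // ->.
Qed.

Section Correctness.

Context {R : realType} {m n : nat} {A : 'M[R]_(m, n)} {b : 'rV[R]_m}.
Implicit Types (x : 'rV[R]_n) (i : 'I_m) (j : 'I_n).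

Lemma result_prog_sum x i (s : seq 'I_n) :
  result (prog_sum 0 1 A x i s) = \sum_(k <- s) TL (A i k) (x ord0 k).
Proof.
rewrite result_loop -[RHS]add0r.
exact: (foldl_addr _ _ (fun k => TL (A i k) (x ord0 k))).
Qed.

(** Each term costs three operations for [prog_TL] and one for adding it. *)
Lemma cost_prog_sum x i (s : seq 'I_n) :
  (cost (prog_sum 0%R 1%R A x i s) <= size s * 4)%N.
Proof. exact: cost_loop. Qed.

Lemma sol_prog_sol x : (forall j, 0 <= x ord0 j <= 1) ->
  sol A b x <-> result (prog_sol 0 1 A b x).
Proof.
move=> x01.
pose S i := \sum_j TL (A i j) (x ord0 j).
have -> : result (prog_sol 0 1 A b x) =
    all (fun i => b ord0 i <= S i) (enum 'I_m).
  rewrite /prog_sol result_loop -[RHS]andTb; elim: (enum 'I_m) true => [|i s IH] ok /=.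
    by rewrite andbT.
  by rewrite IH result_bind result_prog_sum big_enum /= -/(S i) andbA.
split=> [[_ Ax]|/allP Ax]; first by apply/allP => i _.
by split=> // i; apply: Ax; rewrite mem_enum.
Qed.

Lemma cost_prog_sol x : (cost (prog_sol 0%R 1%R A b x) <= m * (n * 4 + 1))%N.
Proof.
rewrite -[X in (_ <= X * _)%N]size_enum_ord; apply: cost_loop => ok i.
rewrite cost_bind leq_add //.
by rewrite -[X in (_ <= X * _)%N]size_enum_ord cost_prog_sum.
Qed.

Definition delta j x : R := result (prog_delta 0 1 A b j x).

(** A number lies below a maximum iff it lies below one of the two arguments; the argument 0 gives
    [c <= s]. *)
Lemma le_TL_add (a t s c : R) :
  (c <= TL a t + s) = (c <= s) || (1 - a + (c - s) <= t).
Proof.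
rewrite /TL -lerBlDr le_max subr_le0 orbC; congr (_ || _).
by apply/idP/idP; lra.
Qed.

(** Characterizing all upper bounds of [delta j x] yields both halves of minimality:
    [t := delta j x] gives feasibility, any feasible [t] the lower bound. *)
Lemma delta_le j x (t : R) :
  delta j x <= t <->
  0 <= t /\ (forall i, b ord0 i <=
    TL (A i j) t + \sum_(k | k != j) TL (A i k) (x ord0 k)).
Proof.
pose S i := \sum_(k | k != j) TL (A i k) (x ord0 k).
rewrite /delta result_bind /= result_bind /= result_loop.
set f := (f in foldl f _ _).
have -> : (foldl f 0 (enum 'I_m) <= t) =
    (0 <= t) && all (fun i => b ord0 i <= TL (A i j) t + S i) (enum 'I_m).
  (* The running maximum [lo] is generalized; its initial value 0 accounts for [0 <= t]. *)
  elim: (enum 'I_m) (0 : R) => [|i s IH] lo /=; first by rewrite andbT.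
  rewrite IH /f result_bind result_prog_sum big_filter big_enum_cond /=.
  rewrite -/(S i) le_TL_add /result /=.
  by case: (b ord0 i <= S i) => //=; rewrite ge_max andbA.
split=> [/andP[t0 /allP At]|[t0 At]]; last by rewrite t0; apply/allP => i _.
by split=> // i; apply: At; rewrite mem_enum.
Qed.

(** The 5 is one test plus, when it fails, two subtractions, an addition and a maximum. *)
Lemma cost_prog_delta j x :
  (cost (prog_delta 0%R 1%R A b j x) <= m * (n * 4 + 5))%N.
Proof.
rewrite /prog_delta /prog_F !cost_bind /= !addn0.
rewrite -[X in (_ <= X * _)%N]size_enum_ord; apply: cost_loop => lo i.
rewrite cost_bind leq_add //; last by rewrite /cost /=; case: ifP.
apply: leq_trans (cost_prog_sum _ _ _) _; rewrite leq_mul2r /=.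
by rewrite size_filter -[X in (_ <= X)%N]size_enum_ord count_size.
Qed.

Lemma sol_Fset j x : sol A b x -> Fset A b j x (x ord0 j).
Proof.
by case=> x01 Ax; split=> // i; rewrite (le_trans (Ax i)) // (bigD1 j).
Qed.

Lemma delta_is_min j x : sol A b x -> is_min (Fset A b j x) (delta j x).
Proof.
move=> /(sol_Fset j) [/andP[xj0 xj1] Axj].
have [d0 Ad] := (delta_le j x (delta j x)).1 (lexx _).
split=> [|t [/andP[t0 _] At]]; last by apply/delta_le.
split=> //; rewrite d0 (le_trans _ xj1) //; exact/delta_le.
Qed.

Lemma sol_set_coord j x (t : R) :
  sol A b x -> Fset A b j x t -> sol A b (set_coord x j t).
Proof.
move=> [x01 _] [t01 At]; split=> [k|i]; first by rewrite mxE; case: ifP.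
rewrite (bigD1 j) //= mxE eqxx (le_trans (At i)) // lerD2l.
by under [leRHS]eq_bigr => k /negbTE kj do rewrite mxE kj.
Qed.

(** [TL] is monotone in its second argument. Hence the minima of the first phase exist. *)
Lemma sol_const1 x : sol A b x -> sol A b (const_mx 1).
Proof.
move=> [x01 Ax]; split=> [j|i]; first by rewrite mxE ler01 lexx.
apply: le_trans (Ax i) _; apply: ler_sum => j _.
have /andP[_ xj1] := x01 j.
by rewrite /TL mxE ge_max !le_max lexx orbT andbT lerD2r lerD2l xj1.
Qed.

(** The second phase for an arbitrary index list, so that prefixes give the intermediate vectors. *)
Definition descend x (s : seq 'I_n) : 'rV[R]_n :=
  foldl (fun y j => set_coord y j (delta j y)) x s.

Lemma sol_descend x (s : seq 'I_n) : sol A b x -> sol A b (descend x s).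
Proof.
elim: s x => //= j s IH x Sx; apply: IH; apply: sol_set_coord => //.
by case: (delta_is_min j x Sx).
Qed.

(** The map [f] covers both phases: constantly the all-ones vector in the first, the identity in the
    second. *)
Lemma result_delta_loop (f : 'rV[R]_n -> 'rV[R]_n) x (s : seq 'I_n) :
  result (loop (fun y j => do d <- prog_delta 0 1 A b j (f y);
                           Ret (set_coord y j d)) x s) =
  foldl (fun y j => set_coord y j (delta j (f y))) x s.
Proof.
by rewrite result_loop; elim: s x => //= j s IH x; rewrite IH result_bind.
Qed.

Lemma cost_delta_loop (f : 'rV[R]_n -> 'rV[R]_n) x :
  (cost (loop (fun y j => do d <- prog_delta 0%R 1%R A b j (f y);
                          Ret (set_coord y j d)) x (enum 'I_n))
   <= n * (m * (n * 4 + 5)))%N.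
Proof.
rewrite -[X in (_ <= X * _)%N]size_enum_ord; apply: cost_loop => y j.
by rewrite cost_bind addn0 cost_prog_delta.
Qed.

Lemma algorithm_is_output x :
  sol A b x -> is_output A b x (result (algorithm 0 1 A b x)).
Proof.
move=> Sx; have S1 := sol_const1 x Sx.
rewrite /algorithm result_bind result_bind.
set xt := result (loop _ (const_mx 1) _).
have xtE j : xt ord0 j = delta j (const_mx 1).
  rewrite /xt (result_delta_loop (fun _ => const_mx 1)).
  by rewrite (foldl_set_coord _ _ (delta^~ (const_mx 1))) mem_enum.
have xt_min j : is_min (Fset A b j (const_mx 1)) (xt ord0 j).
  by rewrite xtE; apply: delta_is_min.
(* [prog_sol] tests only the inequalities, so membership in the unit cube is supplied here. *)
have xt01 j : 0 <= xt ord0 j <= 1 by case: (xt_min j) => -[].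
exists xt; split=> //.
have Sxt := sol_prog_sol xt xt01.
case: ifPn => [/Sxt|/negP nSxt]; first by left.
right; split; first by move=> /Sxt.
exists (fun k => descend x (take k (enum 'I_n))); split.
- by rewrite take0.
- move=> j; exists (delta j (descend x (take j (enum 'I_n)))).
  split; first exact/delta_is_min/sol_descend.
  (* The prefix of length [j.+1] is the one of length [j] followed by the index [j] itself. *)
  rewrite (take_nth j) ?size_enum_ord // nth_ord_enum.
  by rewrite /descend foldl_rcons.
- by rewrite take_oversize ?size_enum_ord // (result_delta_loop id).
Qed.

Lemma cost_algorithm x :
  (cost (algorithm 0%R 1%R A b x) <=
   n * (m * (n * 4 + 5)) + (m * (n * 4 + 1) + n * (m * (n * 4 + 5))))%N.
Proof.
rewrite /algorithm cost_bind leq_add ?(cost_delta_loop (fun=> const_mx 1)) //.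
rewrite cost_bind leq_add ?cost_prog_sol //.
by case: ifP => // _; apply: (cost_delta_loop id).
Qed.

End Correctness.

(** With M the maximum, the left side is at most 8M^3 + 14M^2 + M, and 8 + 14 + 1 = 23. *)
Lemma cubic_bound (m n : nat) :
  (n * (m * (n * 4 + 5)) + (m * (n * 4 + 1) + n * (m * (n * 4 + 5))) <=
   23 * maxn m n ^ 3)%N.
Proof.
have := leq_maxl m n; have := leq_maxr m n; move: (maxn m n) => M nM mM.
have bound c : (m * (n * 4 + c) <= M * (M * 4 + c))%N.
  by rewrite leq_mul // leq_add2r leq_mul2r.
apply: leq_trans (leq_add (leq_mul nM (bound 5))
  (leq_add (bound 1) (leq_mul nM (bound 5)))) _.
rewrite !expnS expn0; case: (posnP M) => [->//|M0]; nia.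
Qed.

Theorem theorem4p5 (R : realType) :
  exists C : nat, forall (m n : nat) (A : 'M[R]_(m, n)) (b : 'rV[R]_m)
    (x : 'rV[R]_n),
    (forall i j, 0 <= A i j <= 1) ->
    (forall i, 0 < b ord0 i) ->
    sol A b x ->
    let: (y, cost) := run (algorithm (0 : R) 1 A b x) in
    is_output A b x y /\ (cost <= C * maxn m n ^ 3)%N.
Proof.
exists 23%N => m n A b x _ _ Sx.
have := algorithm_is_output x Sx; have := cost_algorithm (A := A) (b := b) x.
rewrite /result /cost; case: (run _) => y c /= c_le y_out; split=> //.
exact: leq_trans c_le (cubic_bound m n).
Qed.
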